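(* Let $\Pi\colon D\to Z$ be a Hermitian vector bundle. Denote by $p_1,p_2\colon Z\times Z\to Z$ the natural projections and let $K\colon Z\times Z\to\mathrm{Hom}(p_2^*\Pi,p_1^*\Pi)$ be a reproducing kernel. If $\mathcal H^K$ stands for the reproducing kernel Hilbert space associated with $K$, then there exists a vector bundle homomorphism (in the algebraic sense) $\Delta_K=(\delta_K,\zeta_K)$ from $\Pi$ into the tautological vector bundle $\Pi_{\mathcal H^K}$ such that $K$ is equal to the pull-back of $Q_{\mathcal H^K}$ by $\Delta_K$.
   Context: **Hermitian bundles.** A Hermitian vector bundle is a smooth vector bundle $\Pi\colon D\to Z$ over a Banach manifold $Z$, with typical fiber a complex Banach space $\mathcal E$ and fibers $D_z$, together with a Hermitian structure: a family $(\cdot\mid\cdot)_z\colon D_z\times D_z\to\mathbb C$ ($z\in Z$) of scalar products (linear in the first variable, antilinear in the second) which define the topology of the fibers and depend smoothly on $z$ in local trivializations. (It is the special case of the paper's like-Hermitian bundles where the base involution is the identity.) **Reproducing kernels.** A reproducing kernel on $\Pi$ is a section $K$ of $\mathrm{Hom}(p_2^*\Pi,p_1^*\Pi)$ over $Z\times Z$, i.e. bounded linear operators $K(s,t)\colon D_t\to D_s$, with $\sum_{j,l=1}^n(K(t_l,t_j)\eta_j\mid\eta_l)_{t_l}\ge0$ for all $n\ge1$, $t_j\in Z$, $\eta_j\in D_{t_j}$. For $\xi\in D_s$ put $K_\xi=K(\cdot,s)\xi$; $\mathcal H^K$ is the Hilbert space completion of $\mathrm{span}\{K_\xi\mid\xi\in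 D\}$ for the scalar product $(K_\eta\mid K_\xi)=(K(s,t)\eta\mid\xi)_s$, $\xi\in D_s$, $\eta\in D_t$. **Homomorphisms and pull-backs.** An (algebraic) homomorphism from $\widetilde\Pi\colon\widetilde D\to\widetilde Z$ into $\Pi\colon D\to Z$ is a pair $\Theta=(\delta,\zeta)$ of maps $\delta\colon\widetilde D\to D$, $\zeta\colon\widetilde Z\to Z$ with $\Pi\circ\delta=\zeta\circ\widetilde\Pi$ and $\delta_z:=\delta|_{\widetilde D_z}\colon\widetilde D_z\to D_{\zeta(z)}$ bounded linear for all $z$. With $\delta_s^*\colon D_{\zeta(s)}\to\widetilde D_s$ the adjoint of $\delta_s$ with respect to the fiber scalar products, the pull-back of a kernel $K$ on $\Pi$ is $\Theta^*K(s,t)=\delta_s^*\circ K(\zeta(s),\zeta(t))\circ\delta_t$, $s,t\in\widetilde Z$. **Tautological bundle.** For a complex Hilbert space $\mathcal H$, $\mathrm{Gr}(\mathcal H)$ is the Grassmann manifold of all closed linear subspaces of $\mathcal H$, $\mathcal T(\mathcal H)=\{(\mathcal S,x)\in\mathrm{Gr}(\mathcal H)\times\mathcal H\mid x\in\mathcal S\}$, and $\Pi_{\mathcal H}\colon\mathcal T(\mathcal H)\to\mathrm{Gr}(\mathcal H)$, $(\mathcal S,x)\mapsto\mathcal S$, with the fiber scalar products inherited from $\mathcal H$. The universal reproducing kernel is $Q_{\mathcal H}(\mathcal S_1,\mathcal S_2)=p_{\mathcal S_1}|_{\mathcal S_2}\colon\mathcal S_2\to\mathcal S_1$, where $p_{\mathcal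 S}\colon\mathcal H\to\mathcal S$ is the orthogonal projection. *)

(* Defs.v *)
From HB Require Import structures.
From mathcomp Require Import all_boot all_order all_algebra.
From mathcomp Require Import complex.
From mathcomp Require Import all_classical all_reals all_analysis.

Set Implicit Arguments.
Unset Strict Implicit.
Unset Printing Implicit Defensive.

Import Order.TTheory GRing.Theory Num.Theory.
Import numFieldNormedType.Exports.

Local Open Scope classical_set_scope.
Local Open Scope ring_scope.
Local Open Scope complex_scope.

(* A complex normed space with scalars restricted to the reals. *)
Definition realify (R : realType) (E : normedModType R[i]) : Type := E.

Section Realify.
Context (R : realType) (E : normedModType R[i]).

HB.instance Definition _ := GRing.Zmodule.on (realify E).

Definition realify_scale (a : R) (x : realify E) : realify E :=
  a%:C *: (x : E).

Fact realify_scaleA (a b : R) (x : realify E) :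
  realify_scale a (realify_scale b x) = realify_scale (a * b) x.
Proof. by rewrite /realify_scale scalerA rmorphM. Qed.

Fact realify_scale1 : left_id 1 realify_scale.
Proof. by move=> x; rewrite /realify_scale rmorph1 scale1r. Qed.

Fact realify_scaleDr : right_distributive realify_scale +%R.
Proof. by move=> a x y; rewrite /realify_scale scalerDr. Qed.

Fact realify_scaleDl (x : realify E) :
  {morph realify_scale^~ x : a b / a + b}.
Proof. by move=> a b; rewrite /realify_scale rmorphD scalerDl. Qed.

HB.instance Definition _ := GRing.Zmodule_isLmodule.Build R (realify E)
  realify_scaleA realify_scale1 realify_scaleDr realify_scaleDl.

Definition realify_norm (x : realify E) : R := complex.Re `|(x : E)|.

Fact realify_normE (x : realify E) : (realify_norm x)%:C = `|(x : E)|.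
Proof. by apply: RRe_real; rewrite ger0_real. Qed.

Fact realify_normD (x y : realify E) :
  realify_norm (x + y) <= realify_norm x + realify_norm y.
Proof. by rewrite -lecR rmorphD /= !realify_normE; exact: ler_normD. Qed.

Fact realify_normZ (a : R) (x : realify E) :
  realify_norm (a *: x) = `|a| * realify_norm x.
Proof.
apply: complexI; rewrite rmorphM /= !realify_normE.
have -> : `|a|%:C = `|a%:C|.
  by rewrite normc_def /= expr0n addr0 sqrtr_sqr.
by rewrite -normrZ.
Qed.

Fact realify_norm0 (x : realify E) : realify_norm x = 0 -> x = 0.
Proof.
move=> x0; apply: (@normr0_eq0 _ E).
by rewrite -realify_normE x0.
Qed.

HB.instance Definition _ := Lmodule_isNormed.Build R (realify E)
  realify_normD realify_normZ realify_norm0.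

End Realify.

(* Frechet C^oo on an open set U: D k x v is the k-th derivative of f at x in
   the directions v_0, ..., v_(k-1), a bounded k-linear map in v, and D k.+1 is
   the derivative of D k for the operator norm of k-linear maps. *)
Section Smooth.
Context (R : realType) (V W : normedModType R).

Definition set_arg k (v : 'I_k -> V) (i : 'I_k) (x : V) : 'I_k -> V :=
  fun j => if j == i then x else v j.

Definition cons_arg k (h : V) (v : 'I_k -> V) : 'I_k.+1 -> V :=
  fun i => if unlift ord0 i is Some j then v j else h.

Definition multilinear k (m : ('I_k -> V) -> W) :=
  forall (v : 'I_k -> V) (i : 'I_k) (a : R) (x y : V),
    m (set_arg v i (a *: x + y)) =
    a *: m (set_arg v i x) + m (set_arg v i y).

Definition bounded_multilinear k (m : ('I_k -> V) -> W) :=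
  multilinear m /\
  exists M : R, forall v : 'I_k -> V, `|m v| <= M * \prod_(i < k) `|v i|.

Definition smooth_on (U : set V) (f : V -> W) :=
  exists D : forall k, V -> ('I_k -> V) -> W,
    [/\ forall x v, U x -> D 0 x v = f x,
        forall k x, U x -> bounded_multilinear (D k x)
      & forall k x, U x -> forall e : R, 0 < e ->
          \forall h \near (0 : V), forall v : 'I_k -> V,
            `|D k (x + h) v - D k x v - D k.+1 x (cons_arg h v)|
              <= e * `|h| * \prod_(i < k) `|v i|].

End Smooth.

(* The model space may depend on the chart, so different connected components
   may be modelled on different Banach spaces. *)
Record banach_manifold (R : realType) := BanachManifold {
  mf_space :> topologicalType;
  mf_chart : Type;
  mf_model : mf_chart -> completeNormedModType R;
  mf_dom : mf_chart -> set mf_space;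
  mf_map : forall a : mf_chart, mf_space -> mf_model a;
  mf_inv : forall a : mf_chart, mf_model a -> mf_space;
  mf_dom_open : forall a, open (mf_dom a);
  mf_cover : forall z, exists a, mf_dom a z;
  mf_img_open : forall a, open (@mf_map a @` mf_dom a);
  mf_mapK : forall a z, mf_dom a z -> mf_inv (mf_map a z) = z;
  mf_map_continuous : forall a, {within mf_dom a, continuous (@mf_map a)};
  mf_inv_continuous : forall a,
    {within @mf_map a @` mf_dom a, continuous (@mf_inv a)};
  mf_compatible : forall a b,
    smooth_on (@mf_map a @` (mf_dom a `&` mf_dom b))
      (fun v => mf_map b (@mf_inv a v)) }.

(* Complex vector bundles with typical fiber E.  The fiber over z is a
   topological vector space, identified with E by each trivialization whose
   domain contains z; outside its domain a trivialization is junk. *)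
Record vector_bundle (R : realType) (Z : banach_manifold R)
    (E : completeNormedModType R[i]) := VectorBundle {
  vb_fiber :> Z -> topologicalLmodType R[i];
  vb_triv : Type;
  vb_dom : vb_triv -> set Z;
  vb_map : vb_triv -> forall z : Z, E -> vb_fiber z;
  vb_inv : vb_triv -> forall z : Z, vb_fiber z -> E;
  vb_dom_open : forall i, open (vb_dom i);
  vb_cover : forall z, exists i, vb_dom i z;
  vb_map_linear : forall i z, vb_dom i z -> linear (vb_map i z);
  vb_mapK : forall i z, vb_dom i z -> cancel (vb_map i z) (@vb_inv i z);
  vb_invK : forall i z, vb_dom i z -> cancel (@vb_inv i z) (vb_map i z);
  vb_map_continuous : forall i z, vb_dom i z -> continuous (vb_map i z);
  vb_inv_continuous : forall i z, vb_dom i z -> continuous (@vb_inv i z);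
  vb_compatible : forall i j (a : mf_chart Z),
    smooth_on
      ((@mf_map R Z a @` (mf_dom a `&` vb_dom i `&` vb_dom j)) `*` setT)
      (fun p : (mf_model a * realify E)%type =>
         let z := mf_inv p.1 in
         vb_inv j (vb_map i z p.2) : realify E) }.

Notation scalar_product V := {dot V for @Num.conj_op _}.

Record hermitian_structure (R : realType) (Z : banach_manifold R)
    (E : completeNormedModType R[i]) (D : vector_bundle Z E) :=
  HermitianStructure {
  hs_dot :> forall z : Z, scalar_product (D z);
  hs_topology : forall (z : Z) (x : D z) (A : set (D z)),
    nbhs x A <->
    exists2 e : R, 0 < e &
      forall y : D z, hs_dot z (y - x) (y - x) < (e ^+ 2)%:C -> A y;
  hs_smooth : forall (i : vb_triv D) (a : mf_chart Z),
    smooth_on ((@mf_map R Z a @` (mf_dom a `&` vb_dom i)) `*` setT `*` setT)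
      (fun p : (mf_model a * realify E * realify E)%type =>
         let z := mf_inv p.1.1 in
         hs_dot z (vb_map i z p.1.2) (vb_map i z p.2) : realify R[i]^o) }.

(* What remains of a Hermitian bundle when topology and smoothness are
   forgotten; enough for kernels and for homomorphisms in the algebraic
   sense. *)
Record hbundle (R : realType) := HBundle {
  hb_base :> Type;
  hb_fiber : hb_base -> lmodType R[i];
  hb_dot : forall z, scalar_product (hb_fiber z) }.

Definition hbundle_of (R : realType) (Z : banach_manifold R)
    (E : completeNormedModType R[i]) (D : vector_bundle Z E)
    (h : hermitian_structure D) : hbundle R :=
  @HBundle R Z (fun z => D z) (fun z => h z).

Section Operators.
Context (R : realType) (U V : lmodType R[i]).

Definition dot_norm (W : lmodType R[i]) (d : scalar_product W) (x : W) : R :=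
  Num.sqrt (complex.Re (d x x)).

Definition dot_bounded (dU : scalar_product U) (dV : scalar_product V)
    (T : U -> V) :=
  exists M : R, forall x, dot_norm dV (T x) <= M * dot_norm dU x.

(* Equal to 0 when T has no adjoint. *)
Definition adjoint (dU : scalar_product U) (dV : scalar_product V)
    (T : U -> V) : V -> U :=
  xget (fun=> 0) [set S : V -> U | forall x y, dV (T x) y = dU x (S y)].

End Operators.

Section Kernels.
Context (R : realType).

Definition hom_kernel (B : hbundle R) :=
  forall s t : B, hb_fiber t -> hb_fiber s.

Record reproducing_kernel (B : hbundle R) := ReproducingKernel {
  rk_fun :> forall s t : B, {linear hb_fiber t -> hb_fiber s};
  rk_bounded : forall s t, dot_bounded (hb_dot t) (hb_dot s) (rk_fun s t);
  rk_ge0 : forall n (t : 'I_n -> B) (eta : forall j, hb_fiber (t j)),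
    0 <= \sum_(j < n) \sum_(l < n)
           hb_dot (t l) (rk_fun (t l) (t j) (eta j)) (eta l) }.

(* A pair (delta, zeta) with delta given fiberwise, so that the commutation with
   the bundle projections holds by typing. *)
Record hhom (B1 B2 : hbundle R) := HHom {
  hhom_base : B1 -> B2;
  hhom_fiber : forall z : B1,
    {linear hb_fiber z -> hb_fiber (hhom_base z)};
  hhom_bounded : forall z,
    dot_bounded (hb_dot z) (hb_dot (hhom_base z)) (hhom_fiber z) }.

Definition pull_back (B1 B2 : hbundle R) (Theta : hhom B1 B2)
    (K : hom_kernel B2) : hom_kernel B1 :=
  fun s t eta =>
    adjoint (hb_dot s) (hb_dot (hhom_base Theta s)) (hhom_fiber Theta s)
      (K (hhom_base Theta s) (hhom_base Theta t) (hhom_fiber Theta t eta)).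

End Kernels.

Record hilbert (R : realType) := Hilbert {
  hl_space :> completeNormedModType R[i];
  hl_dot : scalar_product hl_space;
  hl_normE : forall x, hl_dot x x = `|x| ^+ 2 }.

Section RKHS.
Context (R : realType) (B : hbundle R) (K : reproducing_kernel B).

Definition rk_section (s : B) (xi : hb_fiber s) : forall z : B, hb_fiber z :=
  fun z => K z s xi.

Definition rk_span : set (forall z : B, hb_fiber z) :=
  [set f | exists n (a : 'I_n -> R[i]) (s : 'I_n -> B)
             (xi : forall j, hb_fiber (s j)),
           f = fun z => \sum_(j < n) a j *: rk_section (xi j) z].

(* A Hilbert space completion of rk_span, given by an isometric embedding with
   dense range.  The values of rkhs_emb outside rk_span are junk. *)
Record rkhs := RKHS {
  rkhs_space :> hilbert R;
  rkhs_emb : (forall z : B, hb_fiber z) -> rkhs_space;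
  rkhs_emb_linear : forall (a : R[i]) f g, rk_span f -> rk_span g ->
    rkhs_emb (fun z => a *: f z + g z) = a *: rkhs_emb f + rkhs_emb g;
  rkhs_emb_dot : forall (s t : B) (xi : hb_fiber s) (eta : hb_fiber t),
    hl_dot rkhs_space (rkhs_emb (rk_section eta)) (rkhs_emb (rk_section xi)) =
    hb_dot s (K s t eta) xi;
  rkhs_emb_dense : closure (rkhs_emb @` rk_span) = setT }.

End RKHS.

Section Tautological.
Context (R : realType) (H : hilbert R).

Record grassmannian := Grassmannian {
  gr_set :> set H;
  gr_closed : closed gr_set;
  gr_0 : gr_set 0;
  gr_linear : forall (a : R[i]) x y,
    gr_set x -> gr_set y -> gr_set (a *: x + y) }.

Definition gr_pred (S : grassmannian) : {pred H} := fun x => x \in gr_set S.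

Fact gr_submod (S : grassmannian) : submod_closed (gr_pred S).
Proof.
split; first by apply/mem_set/gr_0.
by move=> a x y /set_mem Sx /set_mem Sy; apply/mem_set/gr_linear.
Qed.

HB.instance Definition _ (S : grassmannian) :=
  GRing.isSubmodClosed.Build R[i] H (gr_pred S) (gr_submod S).

Record gr_fiber (S : grassmannian) := GrFiber {
  gr_val : H;
  gr_valP : gr_pred S gr_val }.

HB.instance Definition _ S := [isSub for @gr_val S].
HB.instance Definition _ S := [Choice of gr_fiber S by <:].
HB.instance Definition _ S := [SubChoice_isSubLmodule of gr_fiber S by <:].

Definition gr_dot (S : grassmannian) (x y : gr_fiber S) : R[i] :=
  hl_dot H (gr_val x) (gr_val y).

Section DotInstance.
Variable S : grassmannian.

Fact gr_dot_bilinear :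
  bilinear_for *%R (@Num.conj_op R[i] \; *%R) (@gr_dot S).
Proof.
split=> [y|x] a u v; rewrite /gr_dot /=.
  by rewrite linearPl.
by rewrite linearPr.
Qed.

HB.instance Definition _ := bilinear_isBilinear.Build R[i] (gr_fiber S)
  (gr_fiber S) R[i] _ _ (@gr_dot S) gr_dot_bilinear.

Fact gr_dot_hermitian (x y : gr_fiber S) :
  gr_dot x y = (-1) ^+ false * (gr_dot y x)^*%R.
Proof. exact: hermitian_subproof. Qed.

HB.instance Definition _ := isHermitianSesquilinear.Build R[i] (gr_fiber S)
  false (@Num.conj_op R[i]) (@gr_dot S) gr_dot_hermitian.

Fact gr_dot_gt0 (x : gr_fiber S) : x != 0 -> 0 < gr_dot x x.
Proof. by move=> x0; apply: neq0_dnorm_gt0. Qed.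

HB.instance Definition _ := isDotProduct.Build R[i] (gr_fiber S)
  (@gr_dot S) gr_dot_gt0.

End DotInstance.

(* Gr(H) as a set, without its manifold structure: only homomorphisms in the
   algebraic sense into this bundle are considered.  The total space {S & gr_fiber S}
   is T(H). *)
Definition tautological : hbundle R :=
  @HBundle R grassmannian (fun S => gr_fiber S) (fun S => @gr_dot S).

(* The orthogonal projection of H onto S. *)
Definition orth_proj (S : grassmannian) (x : H) : gr_fiber S :=
  xget 0 [set p | forall y : gr_fiber S, hl_dot H (x - gr_val p) (gr_val y) = 0].

Definition universal_kernel : hom_kernel tautological :=
  fun S1 S2 x => orth_proj S1 (gr_val x).

End Tautological.

Arguments pull_back {R B1 B2} Theta K _ _ _.
Arguments universal_kernel {R} H _ _ _.

(* Main.v *)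
Require Import Defs.
From HB Require Import structures.
From mathcomp Require Import all_boot all_order all_algebra.
From mathcomp Require Import complex.
From mathcomp Require Import all_classical all_reals all_analysis.

(** The kernel factors through its feature map: by construction of the
    reproducing kernel Hilbert space, (K_xi | K_eta) = (xi | K(s,t) eta) for xi
    in D_s and eta in D_t, which says that K(s,t) = delta_s^* delta_t with
    delta_s xi = K_xi.  Here the base map sends every point to the whole space,
    as a point of the Grassmannian, where the universal kernel is the identity;
    thus the pull-back of the universal kernel is exactly delta_s^* delta_t.
    (Sending s to the closure of the range of delta_s instead gives the same
    pull-back, since delta_s^* vanishes on the orthogonal complement of that
    closure.)

    The point that needs an argument is that delta_s^* exists, that is, that
    for each y there is v in D_s with (delta_s xi | y) = (xi | v) for all xi.
    For y = K_eta one can take v = K(s,t) eta, hence v exists for all y in the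
    span of the K_eta, which is dense.  The set of these y is closed when D_s
    is complete, because v depends on y in a Lipschitz way ([adjoint_bound],
    [adjoint_domain_closed]).  Finally D_s is complete because its scalar
    product defines its topology and a local trivialization identifies it
    linearly and homeomorphically with a Banach space ([fiber_complete]). *)

Set Implicit Arguments.
Unset Strict Implicit.
Unset Printing Implicit Defensive.

Import Order.TTheory GRing.Theory Num.Theory.
Import numFieldNormedType.Exports.

Local Open Scope classical_set_scope.
Local Open Scope ring_scope.
Local Open Scope complex_scope.

(** * Norms of scalar products *)

Section ScalarProducts.
Context (R : realType) (V : lmodType R[i]) (d : scalar_product V).

Lemma dot_norm_ge0 x : 0 <= dot_norm d x.
Proof. exact: sqrtr_ge0. Qed.

Lemma dot_normE x : d x x = (dot_norm d x ^+ 2)%:C.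
Proof.
have dx0 : 0 <= d x x by exact: dnorm_ge0.
have re : (complex.Re (d x x))%:C = d x x by exact/RRe_real/ger0_real.
by rewrite sqr_sqrtr ?re // -lecR re.
Qed.

Lemma dot_normN x : dot_norm d (- x) = dot_norm d x.
Proof. by rewrite /dot_norm linearNl linearNr opprK. Qed.

Lemma dot_lt_sqr x e :
  0 < e -> (d x x < (e ^+ 2)%:C) = (dot_norm d x < e).
Proof.
by move=> e0; rewrite dot_normE ltcR ltr_pXn2r // nnegrE ?dot_norm_ge0 ?ltW.
Qed.

Lemma dotC x y : d x y = (d y x)^*%R.
Proof. by rewrite hermC expr0 mul1r. Qed.

(** Expand 0 <= |x - c y|^2 at the coefficient c that makes x - c y orthogonal
    to y. *)
Lemma dot_CauchySchwarz x y :
  `|d x y| <= (dot_norm d x * dot_norm d y)%:C.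
Proof.
have [->|y0] := eqVneq y 0.
  by rewrite linear0r normr0 lecR mulr_ge0 ?dot_norm_ge0.
have dy0 : 0 < d y y by exact: neq0_dnorm_gt0.
have dyJ : (d y y)^*%R = d y y by apply/CrealP/ger0_real/ltW.
have dZl a u v : d (a *: u) v = a * d u v by rewrite linearZl_LR.
have dZr a u v : d u (a *: v) = a^*%R * d u v by rewrite linearZr_LR.
have : 0 <= d (x - (d x y / d y y) *: y) (x - (d x y / d y y) *: y).
  exact: dnorm_ge0.
rewrite linearBl !linearBr /= !dZl !dZr (dotC y x) rmorphM fmorphV /= dyJ.
rewrite divfK ?gt_eqF // subrr subr0.
rewrite subr_ge0 mulrAC ler_pdivrMr // [_^*%R * _]mulrC -normCK => cs.
have E : (dot_norm d x * dot_norm d y)%:C ^+ 2 = d x x * d y y.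
  by rewrite rmorphM /= exprMn -!rmorphXn /= -!dot_normE.
rewrite -(ler_pXn2r (n := 2)) ?nnegrE ?E ?normr_ge0 //.
by rewrite lecR mulr_ge0 ?dot_norm_ge0.
Qed.

Lemma dot_inj v w : (forall x, d x v = d x w) -> v = w.
Proof.
move=> vw; apply/eqP; rewrite -subr_eq0 -(dnorm_eq0 d) linearBr /= vw.
by rewrite subrr.
Qed.

End ScalarProducts.

Section HilbertNorm.
Context (R : realType) (H : hilbert R).
Local Notation N := (dot_norm (hl_dot H)).

Lemma hilbert_normE (x : H) : (N x)%:C = `|x|.
Proof.
apply/eqP; rewrite -(eqrXn2 (n := 2)) ?lecR ?dot_norm_ge0 //.
by rewrite -rmorphXn -hl_normE dot_normE.
Qed.

Lemma hilbert_dist_triangle (x y z : H) : N (x - z) <= N (x - y) + N (y - z).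
Proof. by rewrite -lecR rmorphD /= !hilbert_normE ler_distD. Qed.

Lemma hilbert_ball_nbhs (x : H) (e : R) :
  0 < e -> \forall y \near (x : H), N (y - x) < e.
Proof.
move=> e0; have e0C : 0 < e%:C by rewrite ltcR.
have := nbhsx_ballx x _ e0C; apply: filterS => y.
by rewrite -ball_normE /= distrC -hilbert_normE ltcR.
Qed.

End HilbertNorm.

(** Stated with filters, as is completeness of the typical fiber, and through the
    norm alone, so that it makes sense for a fiber without a topology. *)
Definition dot_complete (R : realType) (V : lmodType R[i])
    (d : scalar_product V) :=
  forall F : set_system V, ProperFilter F ->
    (forall e : R, 0 < e -> exists x, F [set y | dot_norm d (y - x) < e]) ->
    exists x, forall e : R, 0 < e -> F [set y | dot_norm d (y - x) < e].

Lemma dot_cvg (R : realType) (V : lmodType R[i]) (d : scalar_product V)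
    (T : Type) (F : set_system T) {FF : Filter F} (f : T -> V) (x v : V) :
  (forall e : R, 0 < e -> \forall t \near F, dot_norm d (f t - v) < e) ->
  (d x (f t) : R[i]^o) @[t --> F] --> (d x v : R[i]^o).
Proof.
move=> fv; apply/cvgrPdistC_lt => e e0.
have N0 : 0 < dot_norm d x + 1 by rewrite ltr_wpDl ?dot_norm_ge0.
have re : (complex.Re e)%:C = e by exact/RRe_real/gtr0_real.
have e'0 : 0 < complex.Re e by rewrite -ltcR re.
have := fv (complex.Re e / (dot_norm d x + 1)) (divr_gt0 e'0 N0).
apply: filterS => t ft; rewrite -linearBr -re.
apply: le_lt_trans (dot_CauchySchwarz _ _ _) _.
rewrite ltcR mulrC; move: ft; rewrite ltr_pdivlMr //; apply: le_lt_trans.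
by rewrite ler_wpM2l ?dot_norm_ge0 // lerDl.
Qed.

(** * Existence of adjoints *)

Section Adjoint.
Context (R : realType) (V : lmodType R[i]) (d : scalar_product V).
Context (H : hilbert R) (T : {linear V -> H}).
Hypothesis d_complete : dot_complete d.
Hypothesis T_bounded : dot_bounded d (hl_dot H) T.

Definition adjoint_domain : set H :=
  [set y | exists v, forall x, hl_dot H (T x) y = d x v].

(** Take x = v in the defining identity: |v|^2 = (T v | y) <= M |v| |y|. *)
Lemma adjoint_bound : exists2 M : R, 0 < M & forall y v,
  (forall x, hl_dot H (T x) y = d x v) ->
  dot_norm d v <= M * dot_norm (hl_dot H) y.
Proof.
have [M TM] := T_bounded; exists (`|M| + 1) => [|y v vy].
  by rewrite ltr_wpDl.
have [v0|v0] := eqVneq (dot_norm d v) 0.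
  by rewrite v0 mulr_ge0 ?dot_norm_ge0 // addr_ge0.
have {}v0 : 0 < dot_norm d v by rewrite lt_def v0 dot_norm_ge0.
rewrite -(ler_pM2l v0) -expr2 mulrCA mulrA.
have : dot_norm d v ^+ 2 <=
    dot_norm (hl_dot H) (T v) * dot_norm (hl_dot H) y.
  rewrite -lecR; apply: le_trans (dot_CauchySchwarz _ _ _).
  by rewrite vy -dot_normE ger0_norm ?dnorm_ge0.
move=> /le_trans; apply; apply: ler_wpM2r; first exact: dot_norm_ge0.
apply: le_trans (TM v) _; apply: ler_wpM2r; first exact: dot_norm_ge0.
by rewrite (le_trans (ler_norm M)) // lerDl.
Qed.

(** Near a limit point y, the representing vectors g z form a Cauchy filter by
    the Lipschitz estimate; their limit represents y because both sides of
    (T x | z) = (x | g z) pass to the limit. *)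
Lemma adjoint_domain_closed : closed adjoint_domain.
Proof.
move=> y cy; have [M M0 bound] := adjoint_bound.
have /choice[g gP] : forall y, exists v,
    adjoint_domain y -> forall x, hl_dot H (T x) y = d x v.
  move=> z; have [[v vP]|nz] := pselect (adjoint_domain z).
    by exists v.
  by exists 0 => /nz.
have FF : ProperFilter (within adjoint_domain (nbhs y)).
  exact: within_nbhs_proper.
have near_dom : \forall z \near within adjoint_domain (nbhs y),
    adjoint_domain z by exact: withinT.
have near_y (e : R) : 0 < e -> \forall z \near within adjoint_domain (nbhs y),
    dot_norm (hl_dot H) (z - y) < e.
  by move=> e0; apply: cvg_within; exact: hilbert_ball_nbhs.
have g_lip z z' : adjoint_domain z -> adjoint_domain z' ->
    dot_norm d (g z - g z') <= M * dot_norm (hl_dot H) (z - z').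
  by move=> Gz Gz'; apply: bound => x; rewrite !linearBr /= !gP.
have [|v gv] := d_complete (fmap_proper_filter g FF).
  (* By the triangle inequality, two points within e / 2M of y are within e / M of each other. *)
  move=> e e0; have r0 : 0 < e / (M * 2) by rewrite divr_gt0 ?mulr_gt0.
  have near_r := near_y _ r0.
  have [z0 [Gz0 z0y]] := filter_ex (filterI near_dom near_r).
  exists (g z0); apply: filterS (filterI near_dom near_r) => z [Gz zy] /=.
  apply: le_lt_trans (g_lip _ _ Gz Gz0) _.
  rewrite mulrC -ltr_pdivlMr //.
  apply: le_lt_trans (hilbert_dist_triangle z y z0) _.
  rewrite -(dot_normN _ (y - z0)) opprB.
  by apply: lt_le_trans (ltrD zy z0y) _; rewrite invfM mulrA -splitr.
exists v => x.
apply: (@cvg_unique _ (@norm_hausdorff _ R[i]^o)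
  ((hl_dot H (T x) z : R[i]^o) @[z --> within adjoint_domain (nbhs y)])).
  exact: dot_cvg.
have : (d x (g z) : R[i]^o) @[z --> within adjoint_domain (nbhs y)]
    --> (d x v : R[i]^o).
  by apply: dot_cvg => e; exact: gv.
apply: cvg_trans; apply: near_eq_cvg.
by apply: filterS near_dom => z Gz; rewrite gP.
Qed.

Lemma adjoint_domain_full (A : set H) :
  closure A = setT -> A `<=` adjoint_domain -> adjoint_domain = setT.
Proof.
move=> dA sA; apply/seteqP; split=> // y _.
by apply: adjoint_domain_closed; apply: (closure_subset sA); rewrite dA.
Qed.

End Adjoint.

Lemma adjointP (R : realType) (U V : lmodType R[i]) (dU : scalar_product U)
    (dV : scalar_product V) (T : U -> V) :
  (forall y, exists v, forall x, dV (T x) y = dU x v) ->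
  forall x y, dV (T x) y = dU x (adjoint dU dV T y).
Proof.
move=> /choice[S SP]; rewrite /adjoint.
by case: xgetP => [S' _ //|/(_ S)[]] x y; exact: SP.
Qed.

(** * Completeness of the fibers *)

Section Fibers.
Context (R : realType) (Z : banach_manifold R) (E : completeNormedModType R[i]).
Context (D : vector_bundle Z E) (h : hermitian_structure D) (z : Z).

Lemma fiber_nbhs (x : D z) (A : set (D z)) :
  nbhs x A <->
  exists2 e : R, 0 < e & forall y, dot_norm (h z) (y - x) < e -> A y.
Proof.
rewrite hs_topology; split=> -[e e0 eA]; exists e => // y.
  by rewrite -dot_lt_sqr //; exact: eA.
by rewrite dot_lt_sqr //; exact: eA.
Qed.

(** The inverse of a trivialization is linear and continuous at 0, so it maps
    a Cauchy filter of the fiber to a Cauchy filter of the typical fiber; the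
    trivialization carries the limit back. *)
Lemma fiber_complete : dot_complete (h z).
Proof.
move=> F FF cF; have [i iz] := @vb_cover _ _ _ D z.
pose inv := @vb_inv _ _ _ D i z.
have invB : {morph inv : x y / x - y}.
  move=> x y; apply: (can_inj (vb_mapK iz)).
  rewrite !vb_invK // [in RHS]addrC -[- inv y]scaleN1r (vb_map_linear iz).
  by rewrite !vb_invK // scaleN1r addrC.
have inv0 : inv 0 = 0 by rewrite -(subrr 0) invB subrr.
have cvF : cvg (inv @ F).
  apply: cauchy_cvg; apply: cauchy_exP => e e0.
  have : nbhs (0 : D z) (inv @^-1` ball 0 e).
    by apply: vb_inv_continuous => //; rewrite -/inv inv0; exact: nbhsx_ballx.
  move=> /fiber_nbhs[r r0 rP]; have [x Fx] := cF r r0.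
  exists (inv x); suff : F (inv @^-1` ball (inv x) e) by [].
  apply: filterS Fx => y /= yx.
  have := rP (y - x); rewrite subr0 => /(_ yx) /=.
  by rewrite invB -!ball_normE /= sub0r normrN distrC.
exists (vb_map i z (lim (inv @ F))) => e e0; set A := [set y | _].
have : nbhs (vb_map i z (lim (inv @ F))) A by apply/fiber_nbhs; exists e.
move=> /(vb_map_continuous iz)/cvF FA.
have : F (inv @^-1` (vb_map i z @^-1` A)) by exact: FA.
by apply: filterS => x; rewrite /= vb_invK.
Qed.

End Fibers.

(** * The feature map of a kernel *)

Lemma orth_proj_val (R : realType) (H : hilbert R) (S : grassmannian H)
    (p : gr_fiber S) : orth_proj S (gr_val p) = p.
Proof.
apply: xget_unique => [q|q /(_ (p - q)) /eqP]; first by rewrite subrr linear0l.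
have <- : gr_val (p - q) = gr_val p - gr_val q by [].
by rewrite dnorm_eq0 => /eqP pq; apply/esym/subr0_eq/val_inj.
Qed.

Section WholeSpace.
Context (R : realType) (H : hilbert R).

Definition whole_space : grassmannian H :=
  @Grassmannian R H setT closedT I (fun _ _ _ _ _ => I).

Definition in_whole (x : H) : gr_fiber whole_space :=
  @GrFiber R H whole_space x (mem_setT x).

End WholeSpace.

Section FeatureMap.
Context (R : realType) (B : hbundle R) (K : reproducing_kernel B).
Context (HK : rkhs K).

Definition feature_map (s : B) (xi : hb_fiber s) : HK :=
  rkhs_emb HK (rk_section K xi).

Lemma rk_span_section (s : B) (xi : hb_fiber s) : rk_span K (rk_section K xi).
Proof.
exists 1, (fun=> 1), (fun=> s), (fun=> xi).
by apply/functional_extensionality_dep => z; rewrite big_ord1 scale1r.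
Qed.

Lemma feature_map_linear s : linear (@feature_map s).
Proof.
move=> a x y; rewrite /feature_map -rkhs_emb_linear; last first.
- exact: rk_span_section.
- exact: rk_span_section.
congr (rkhs_emb HK _); apply/functional_extensionality_dep => z.
by rewrite /rk_section linearP.
Qed.

(** The identity K(s,t) = delta_s^* delta_t in weak form. *)
Lemma feature_map_dot s t (xi : hb_fiber s) (eta : hb_fiber t) :
  hl_dot HK (feature_map xi) (feature_map eta) = hb_dot s xi (K s t eta).
Proof. by rewrite [LHS]dotC rkhs_emb_dot -dotC. Qed.

(** |K_xi|^2 = (xi | K(s,s) xi) <= |M| |xi|^2 when M bounds K(s,s). *)
Lemma feature_map_bounded s :
  dot_bounded (hb_dot s) (hl_dot HK) (@feature_map s).
Proof.
have [M KM] := rk_bounded K s s; exists (Num.sqrt `|M|) => x.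
rewrite -(ler_pXn2r (n := 2)) ?nnegrE ?mulr_ge0 ?dot_norm_ge0 ?sqrtr_ge0 //.
rewrite exprMn (sqr_sqrtr (normr_ge0 M)).
have le1 : dot_norm (hl_dot HK) (feature_map x) ^+ 2 <=
    dot_norm (hb_dot s) x * dot_norm (hb_dot s) (K s s x).
  rewrite -lecR -dot_normE -[leLHS]ger0_norm ?dnorm_ge0 //.
  by rewrite feature_map_dot dot_CauchySchwarz.
apply: le_trans le1 _; rewrite expr2 mulrCA ler_wpM2l ?dot_norm_ge0 //.
by apply: le_trans (KM x) _; rewrite ler_wpM2r ?dot_norm_ge0 ?ler_norm.
Qed.

HB.instance Definition _ s := GRing.isLinear.Build R[i] (hb_fiber s) HK _
  (@feature_map s) (@feature_map_linear s).

(** Linearity of the embedding holds on the span only, so the sections that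
    occur have to stay in it: terms are split off one at a time, and the zero
    section enters as the empty combination. *)
Lemma rkhs_emb_sum n (a : 'I_n -> R[i]) (t : 'I_n -> B)
    (eta : forall j, hb_fiber (t j)) :
  rkhs_emb HK (fun z => \sum_(j < n) a j *: rk_section K (eta j) z) =
  \sum_(j < n) a j *: feature_map (eta j).
Proof.
elim: n a t eta => [|n IH] a t eta.
  rewrite big_ord0; set f := fun z => _.
  have f0 : rk_span K f by exists 0, a, t, eta.
  have := rkhs_emb_linear HK (-1) f0 f0; rewrite scaleN1r addNr => <-.
  congr (rkhs_emb HK _); apply/functional_extensionality_dep => z.
  by rewrite scaleN1r addNr /f big_ord0.
rewrite big_ord_recl -IH -rkhs_emb_linear; last first.
- by exists n, (fun j => a (lift ord0 j)), (fun j => t (lift ord0 j)),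
    (fun j => eta (lift ord0 j)).
- exact: rk_span_section.
congr (rkhs_emb HK _); apply/functional_extensionality_dep => z.
by rewrite big_ord_recl.
Qed.

(** At K_eta, with eta over t, the adjoint of the feature map over s takes the
    value K(s,t) eta. *)
Lemma rk_span_adjoint_domain s :
  rkhs_emb HK @` rk_span K `<=` adjoint_domain (hb_dot s) (@feature_map s).
Proof.
move=> _ [_ [n [a [t [eta ->]]] <-]].
exists (\sum_(j < n) a j *: K s (t j) (eta j)) => x.
rewrite rkhs_emb_sum !linear_sumr /=; apply: eq_bigr => j _.
by rewrite !linearZr_LR /= feature_map_dot.
Qed.

Definition feature_fiber (s : B) (xi : hb_fiber s) : gr_fiber (whole_space HK) :=
  in_whole (feature_map xi).

Lemma feature_fiber_linear s : linear (@feature_fiber s).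
Proof. by move=> a x y; apply: val_inj; exact: feature_map_linear. Qed.

HB.instance Definition _ s := GRing.isLinear.Build R[i] (hb_fiber s)
  (gr_fiber (whole_space HK)) _ (@feature_fiber s) (@feature_fiber_linear s).

Definition feature_hom : hhom B (tautological HK) :=
  @HHom R B (tautological HK) (fun=> whole_space HK)
    (fun s => @feature_fiber s) feature_map_bounded.

(** (x | delta_s^* delta_t eta) = (delta_s x | delta_t eta) = (x | K(s,t) eta)
    for all x in D_s; completeness makes the adjoint delta_s^* exist. *)
Theorem kernel_eq_pull_back : (forall s, dot_complete (@hb_dot R B s)) ->
  forall s t, K s t =1 pull_back feature_hom (universal_kernel HK) s t.
Proof.
move=> complete s t eta; rewrite /pull_back /universal_kernel orth_proj_val.
apply: (@dot_inj _ _ (hb_dot s)) => x; rewrite -adjointP.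
  by rewrite -feature_map_dot.
move=> y.
have dom : adjoint_domain (hb_dot s) (@feature_map s) = setT.
  apply: adjoint_domain_full (rkhs_emb_dense HK) (@rk_span_adjoint_domain s).
  - exact: complete.
  - exact: feature_map_bounded.
suff : adjoint_domain (hb_dot s) (@feature_map s) (gr_val y) by [].
by rewrite dom.
Qed.

End FeatureMap.

Theorem theorem6p2 (R : realType) (Z : banach_manifold R)
    (E : completeNormedModType R[i]) (D : vector_bundle Z E)
    (h : hermitian_structure D)
    (K : reproducing_kernel (hbundle_of h)) (HK : rkhs K) :
  exists Delta : hhom (hbundle_of h) (tautological HK),
    forall s t : Z, K s t =1 pull_back Delta (universal_kernel HK) s t.
Proof.
exists (feature_hom HK) => s t.
exact: (kernel_eq_pull_back (B := hbundle_of h) HK (@fiber_complete _ _ _ _ h)).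
Qed.
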